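(* Let $f:\mathbb{R}^2\to\mathbb{R}^2$ be defined by $f(\theta)=\theta$ and $f((x_1,x_2))=\left(\frac{x_1^2-x_2^2}{\sqrt{x_1^2+x_2^2}},\frac{2x_1x_2}{\sqrt{x_1^2+x_2^2}}\right)$ for $(x_1,x_2)\in\mathbb{R}^2\setminus\{\theta\}$, where $\theta$ is the origin. Then $$\hat{\alpha}(f,\bar z,f(\bar z))=1\quad\text{for any }\bar z\in\mathbb{R}^2.$$
   Context: $\mathbb{R}^n$ carries the Euclidean norm $\|\cdot\|$ and inner product $\langle\cdot,\cdot\rangle$. For continuous $g:\mathbb{R}^n\to\mathbb{R}^n$ and $x,y\in\mathbb{R}^n$, the Mordukhovich derivative (coderivative) is the set $$\widehat{D}^*g(x)(y)=\left\{z\in\mathbb{R}^n:\ \limsup_{u\to x}\frac{\langle z,u-x\rangle-\langle y,g(u)-g(x)\rangle}{\|u-x\|+\|g(u)-g(x)\|}\le 0\right\}.$$ For $\bar z,\bar w\in\mathbb{R}^n$ with $\bar w=g(\bar z)$, the covering constant of $g$ at $(\bar z,\bar w)$ is $$\hat\alpha(g,\bar z,\bar w)=\sup_{\eta>0}\inf\{\|x\|:\ x\in\widehat{D}^*g(z)(y),\ z\in\mathbb{B}(\bar z,\eta),\ g(z)\in\mathbb{B}(\bar w,\eta),\ \|y\|=1\},$$ where $\mathbb{B}(p,\eta)$ is the closed ball of radius $\eta$ centered at $p$, and the infimum ranges over all such $x,z,y\in\mathbb{R}^n$. *)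

(* Defs.v *)
From HB Require Import structures.
From mathcomp Require Import all_boot all_order all_algebra.
From mathcomp Require Import all_classical all_reals all_analysis.
Set Implicit Arguments.
Unset Strict Implicit.
Unset Printing Implicit Defensive.
Import Order.TTheory GRing.Theory Num.Theory.
Import numFieldNormedType.Exports.
Local Open Scope classical_set_scope.
Local Open Scope ring_scope.

Definition inner (R : realType) (n : nat) (x y : 'rV[R]_n) : R :=
  \sum_(i < n) x 0 i * y 0 i.

(* The norm `|x| that MathComp-Analysis puts on 'rV[R]_n is the sup norm; it
   induces the same topology but not the same distances. *)
Definition enorm (R : realType) (n : nat) (x : 'rV[R]_n) : R :=
  Num.sqrt (inner x x).

Definition eclosed_ball (R : realType) (n : nat) (p : 'rV[R]_n) (eta : R) :
  set 'rV[R]_n := [set x | enorm (x - p) <= eta].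

(* The upper limit is over u -> x with u != x (the quotient is 0 / 0 at
   u = x). It is taken in the extended reals. *)
Definition coderivative (R : realType) (n : nat) (g : 'rV[R]_n -> 'rV[R]_n)
    (x y : 'rV[R]_n) : set 'rV[R]_n :=
  [set z | (limf_esup (fun u : 'rV[R]_n =>
      ((inner z (u - x) - inner y (g u - g x))
         / (enorm (u - x) + enorm (g u - g x)))%:E) x^' <= 0)%E].

(* Extended-real valued, with the usual convention inf(empty set) = +oo. *)
Definition covering_constant (R : realType) (n : nat)
    (g : 'rV[R]_n -> 'rV[R]_n) (zbar wbar : 'rV[R]_n) : \bar R :=
  ereal_sup [set ereal_inf [set r : \bar R | exists x z y : 'rV[R]_n,
        [/\ coderivative g z y x,
            eclosed_ball zbar eta z,
            eclosed_ball wbar eta (g z),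
            enorm y = 1
          & r = (enorm x)%:E]]
    | eta in [set eta : R | 0 < eta]].

Definition f (R : realType) (x : 'rV[R]_2) : 'rV[R]_2 :=
  let x1 := x 0 0 in
  let x2 := x 0 1 in
  let d := Num.sqrt (x1 ^+ 2 + x2 ^+ 2) in
  if x == 0 then 0
  else \row_(j < 2) (if j == 0 then (x1 ^+ 2 - x2 ^+ 2) / d
                     else (2 * x1 * x2) / d).

(* Main.v *)
Require Import Defs.
From HB Require Import structures.
From mathcomp Require Import all_boot all_order all_algebra.
From mathcomp Require Import all_classical all_reals all_analysis.
From mathcomp Require Import ring lra.
Import Order.TTheory GRing.Theory Num.Theory.
Import numFieldNormedType.Exports.
Local Open Scope classical_set_scope.
Local Open Scope ring_scope.

(** In polar coordinates [f] is (r, phi) |-> (r, 2 phi): it keeps the modulus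
    and doubles the angle. So away from the origin it is an isometry in the
    radial direction and stretches by 2 in the tangential one; the smallest
    stretching factor, 1, is the covering constant. The argument below does not
    differentiate [f], and its lower bound covers the origin, where [f] is not
    differentiable, together with the other points.

    Lower bound. If p is the angle between u and z and p <= pi/2, then
    cos (2p) <= cos p, so [f] does not decrease the distance from u to z
    ([f_expand]). Every value w has two opposite preimages, and one of them
    makes a nonobtuse angle with z; it therefore lies within |w - f z| of z
    ([f_open]). Testing the inequality that defines the coderivative on the
    preimages of f z - t y, for small t > 0, gives |x| >= 1 for every x in
    D^*f(z)(y) with |y| = 1 ([coderivative_enorm_ge1]).

    Upper bound. At z <> 0 the radial direction gives a pair attaining 1:
    x = z / |z| lies in D^*f(z)(y) for y = f z / |z|
    ([coderivative_f_radial]). Such a point z exists arbitrarily close to any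
    prescribed one, the origin included.

    Both halves rest on the formula
    |x| |y| <f x, f y> = 2 <x, y>^2 - |x|^2 |y|^2 ([inner_f]), which is
    cos (2p) = 2 (cos p)^2 - 1. *)

(** * The Euclidean norm and the coderivative *)

Section Euclid.
Context {R : realType} {n : nat}.
Implicit Types (x y z u v w : 'rV[R]_n) (a d e t : R).

Lemma innerC x y : inner x y = inner y x.
Proof. by apply: eq_bigr => i _; rewrite mulrC. Qed.

Lemma innerDl x y z : inner (x + y) z = inner x z + inner y z.
Proof. by rewrite -big_split; apply: eq_bigr => i _; rewrite mxE mulrDl. Qed.

Lemma innerZl a x y : inner (a *: x) y = a * inner x y.
Proof. by rewrite mulr_sumr; apply: eq_bigr => i _; rewrite mxE mulrA. Qed.

Lemma innerNl x y : inner (- x) y = - inner x y.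
Proof. by rewrite -scaleN1r innerZl mulN1r. Qed.

Lemma innerBl x y z : inner (x - y) z = inner x z - inner y z.
Proof. by rewrite innerDl innerNl. Qed.

Lemma innerBr x y z : inner x (y - z) = inner x y - inner x z.
Proof. by rewrite innerC innerBl !(innerC x). Qed.

Lemma innerZr a x y : inner x (a *: y) = a * inner x y.
Proof. by rewrite innerC innerZl innerC. Qed.

Lemma inner_ge0 x : 0 <= inner x x.
Proof. by apply: sumr_ge0 => i _; rewrite -expr2 sqr_ge0. Qed.

Lemma enorm_ge0 x : 0 <= enorm x.
Proof. exact: sqrtr_ge0. Qed.

Lemma sqr_enorm x : enorm x ^+ 2 = inner x x.
Proof. by rewrite sqr_sqrtr // inner_ge0. Qed.

Lemma enorm_sqrP x a : 0 <= a -> inner x x = a ^+ 2 -> enorm x = a.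
Proof. by move=> a0 xa; rewrite /enorm xa sqrtr_sqr ger0_norm. Qed.

Lemma enormZ a x : enorm (a *: x) = `|a| * enorm x.
Proof.
apply: enorm_sqrP; first by rewrite mulr_ge0 // enorm_ge0.
by rewrite innerZl innerZr exprMn sqr_enorm real_normK ?num_real // mulrA.
Qed.

Lemma normr_coord_le x i : `|x 0 i| <= enorm x.
Proof.
rewrite -ler_sqr ?nnegrE ?enorm_ge0 // sqr_enorm real_normK ?num_real //.
rewrite /inner (bigD1 i) //= expr2 lerDl.
by apply: sumr_ge0 => j _; rewrite -expr2 sqr_ge0.
Qed.

Lemma enorm_eq0 x : (enorm x == 0) = (x == 0).
Proof.
apply/eqP/eqP => [x0|->]; last first.
  by apply: enorm_sqrP => //; rewrite /inner big1 ?expr0n // => i _; rewrite mxE mul0r.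
apply/rowP => i; rewrite mxE; apply/eqP; rewrite -normr_le0 -x0.
exact: normr_coord_le.
Qed.

Lemma enorm0 : enorm (0 : 'rV[R]_n) = 0.
Proof. by apply/eqP; rewrite enorm_eq0. Qed.

Lemma sqr_enormB x y :
  enorm (x - y) ^+ 2 = enorm x ^+ 2 + enorm y ^+ 2 - 2 * inner x y.
Proof. by rewrite !sqr_enorm innerBl !innerBr (innerC y x); ring. Qed.

(** Cauchy-Schwarz, from the square of the length of |y| x - |x| y. *)
Lemma inner_le_enorm x y : inner x y <= enorm x * enorm y.
Proof.
have [y0|y0] := eqVneq (enorm y) 0.
  move/eqP: (y0); rewrite enorm_eq0 => /eqP ->.
  by rewrite enorm0 mulr0 /inner big1 // => i _; rewrite mxE mulr0.
have py : 0 < enorm y by rewrite lt_def y0 enorm_ge0.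
have [x0|x0] := eqVneq (enorm x) 0.
  move/eqP: (x0); rewrite enorm_eq0 => /eqP ->.
  by rewrite enorm0 mul0r /inner big1 // => i _; rewrite mxE mul0r.
have px : 0 < enorm x by rewrite lt_def x0 enorm_ge0.
have := sqr_ge0 (enorm (enorm y *: x - enorm x *: y)).
rewrite sqr_enormB !enormZ !ger0_norm ?enorm_ge0 // innerZl innerZr => h.
rewrite -(ler_pM2l (mulr_gt0 px py)); move: h; lra.
Qed.

(** The topology of row vectors comes from the sup norm; this passes to the
    Euclidean distances in which the coderivative is expressed. *)
Lemma nbhs_enormP x (P : set 'rV[R]_n) :
  nbhs x P <-> exists2 d, 0 < d & forall u, enorm (u - x) < d -> P u.
Proof.
split=> [/nbhs_ballP[d /= d0 dP]|[d d0 dP]].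
  exists d => // u ud; apply: dP; split=> // i j.
  rewrite (ord1 i) -ball_normE /= distrC.
  by apply: le_lt_trans ud; have := normr_coord_le (u - x) j; rewrite !mxE.
(* Coordinates below d / (n + 1) give a squared length of at most
   n (d / (n + 1))^2 < d^2; the successor also covers n = 0. *)
apply/nbhs_ballP; exists (d / n.+1%:R); first by rewrite /= divr_gt0.
move=> u [_ xu]; apply: dP.
rewrite -ltr_sqr ?nnegrE ?enorm_ge0 ?ltW // sqr_enorm.
set e := d / n.+1%:R in xu.
have -> : d = e * n.+1%:R by rewrite /e mulfVK.
have e0 : 0 < e by rewrite divr_gt0.
clearbody e; apply: (@le_lt_trans _ _ (\sum_(i < n) e ^+ 2)).
  apply: ler_sum => i _; rewrite -expr2 -real_normK ?num_real //.
  rewrite ler_sqr ?nnegrE // ?ltW // !mxE distrC.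
  by have := xu 0 i; rewrite -ball_normE.
rewrite sumr_const card_ord -[_ *+ n]mulr_natr exprMn ltr_pM2l ?exprn_gt0 //.
by rewrite -natrX ltr_nat; apply: (@leq_trans n.+1) => //; rewrite leq_pmull.
Qed.

(** Clearing the denominator, which is positive for u <> x, lets u = x be
    included, where both sides vanish. *)
Lemma coderivativeP (g : 'rV[R]_n -> 'rV[R]_n) x y z :
  coderivative g x y z <->
  forall e, 0 < e -> exists2 d, 0 < d & forall u, enorm (u - x) < d ->
    inner z (u - x) - inner y (g u - g x)
      <= e * (enorm (u - x) + enorm (g u - g x)).
Proof.
have den_gt0 u : u != x -> 0 < enorm (u - x) + enorm (g u - g x).
  move=> ux; rewrite ltr_pwDl ?enorm_ge0 //.
  by rewrite lt_def enorm_ge0 enorm_eq0 subr_eq0 ux.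
split=> [zD e e0|H].
  have : (limf_esup (fun u : 'rV[R]_n =>
      ((inner z (u - x) - inner y (g u - g x))
         / (enorm (u - x) + enorm (g u - g x)))%:E) x^' < e%:E)%E.
    by apply: le_lt_trans zD _; rewrite lte_fin.
  move=> /ereal_inf_lt[_ [A xA <-] Ae].
  have /nbhs_enormP[d d0 dA] : nbhs x [set u | u != x -> A u] by exact: xA.
  exists d => // u ud.
  have [->|ux] := eqVneq u x.
    by rewrite !innerBr !subrr enorm0 addr0 mulr0.
  rewrite -ler_pdivrMr ?den_gt0 // -lee_fin; apply: le_trans (ltW Ae).
  by apply: ereal_sup_ubound; exists u => //; exact: dA.
apply/lee_addgt0Pr => e e0; rewrite add0e.
have [d d0 dH] := H e e0.
apply: ge_ereal_inf.
pose A := [set u : 'rV[R]_n | u != x /\ enorm (u - x) < d].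
exists (ereal_sup [set ((inner z (u - x) - inner y (g u - g x))
         / (enorm (u - x) + enorm (g u - g x)))%:E | u in A]).
  exists A => //; suff : nbhs x [set u | u != x -> A u] by [].
  by apply/nbhs_enormP; exists d.
apply: ge_ereal_sup => _ [u [ux ud] <-].
by rewrite lee_fin ler_pdivrMr ?den_gt0 // dH.
Qed.

(** If u is a preimage of g x - t y with |u - x| <= t, then
    t = - <y, g u - g x> is at most |z| |u - x| + o(t) <= (|z| + o(1)) t. *)
Lemma coderivative_enorm_ge1 (g : 'rV[R]_n -> 'rV[R]_n) x y z :
  (forall w, exists2 u, g u = w & enorm (u - x) <= enorm (w - g x)) ->
  coderivative g x y z -> enorm y = 1 -> 1 <= enorm z.
Proof.
move=> g_open /coderivativeP zD y1; apply/ler_addgt0Pr => e e0.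
have [d d0 dD] := zD (e / 2) (divr_gt0 e0 (ltr0n _ 2)).
pose t := d / 2; have t0 : 0 < t by rewrite divr_gt0.
have td : t < d by rewrite /t; lra.
have [u gu] := g_open (g x - t *: y).
rewrite addrAC subrr add0r -scaleNr enormZ normrN gtr0_norm // y1 mulr1 => ut.
have := dD u; rewrite gu addrAC subrr add0r -scaleNr innerZr enormZ normrN.
rewrite gtr0_norm // -sqr_enorm y1 expr1n !mulr1 => h.
have {}h := h (le_lt_trans ut td).
have zu : - inner z (u - x) <= enorm z * enorm (u - x).
  rewrite -innerNl; apply: le_trans (inner_le_enorm _ _) _.
  by rewrite -scaleN1r enormZ normrN1 mul1r.
rewrite -(ler_pM2l t0) mulr1.
have zt := ler_wpM2l (enorm_ge0 z) ut.
have et : e / 2 * (enorm (u - x) + t) <= e * t.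
  have := ler_wpM2l (ltW e0) ut; lra.
move: h zu zt et; lra.
Qed.

End Euclid.

(** * The angle-doubling map *)

Section AngleDoubling.
Context {R : realType}.
Implicit Types u w x y z : 'rV[R]_2.

Lemma inner2E x y : inner x y = x 0 0 * y 0 0 + x 0 1 * y 0 1.
Proof.
rewrite /inner !big_ord_recl big_ord0 addr0.
by have -> : lift ord0 ord0 = 1 :> 'I_2 by exact/val_inj.
Qed.

Lemma f0 : f (0 : 'rV[R]_2) = 0.
Proof. by rewrite /f eqxx. Qed.

(** |x| f(x) is the complex square of x; in this form the
    formula extends to the origin. *)
Lemma enorm_fE x :
  enorm x * f x 0 0 = x 0 0 ^+ 2 - x 0 1 ^+ 2 /\
  enorm x * f x 0 1 = 2 * x 0 0 * x 0 1.
Proof.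
have [->|x0] := eqVneq x 0; first by rewrite f0 enorm0 !mxE; split; ring.
have dE : Num.sqrt (x 0 0 ^+ 2 + x 0 1 ^+ 2) = enorm x.
  by rewrite /enorm inner2E.
have d0 : enorm x != 0 by rewrite enorm_eq0.
by rewrite /f (negbTE x0) !mxE /= dE; split; rewrite mulrC divfK.
Qed.

Lemma enorm2E x : enorm x ^+ 2 = x 0 0 ^+ 2 + x 0 1 ^+ 2.
Proof. by rewrite sqr_enorm inner2E. Qed.

(** The double-angle formula for the cosine, multiplied out so that it also
    holds when x or y vanishes. *)
Lemma inner_f x y :
  enorm x * enorm y * inner (f x) (f y)
    = 2 * inner x y ^+ 2 - (enorm x * enorm y) ^+ 2.
Proof.
have [x1 x2] := enorm_fE x; have [y1 y2] := enorm_fE y.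
have -> : enorm x * enorm y * inner (f x) (f y) =
    (enorm x * f x 0 0) * (enorm y * f y 0 0) +
    (enorm x * f x 0 1) * (enorm y * f y 0 1) by rewrite inner2E; ring.
by rewrite x1 x2 y1 y2 exprMn !enorm2E inner2E; ring.
Qed.

Lemma enorm_f x : enorm (f x) = enorm x.
Proof.
have [->|x0] := eqVneq x 0; first by rewrite f0.
have d0 : enorm x != 0 by rewrite enorm_eq0.
apply: enorm_sqrP; first exact: enorm_ge0.
apply: (mulfI (mulf_neq0 d0 d0)).
by rewrite inner_f -sqr_enorm; ring.
Qed.

Lemma f_eq w x : w != 0 -> enorm x = enorm w ->
  x 0 0 ^+ 2 - x 0 1 ^+ 2 = enorm w * w 0 0 ->
  2 * x 0 0 * x 0 1 = enorm w * w 0 1 -> f x = w.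
Proof.
rewrite -enorm_eq0 => w0 xw e0 e1; have [] := enorm_fE x.
rewrite e0 e1 xw => /(mulfI w0) h0 /(mulfI w0) h1.
apply/rowP => i; case: (unliftP 0 i) => [j ->|-> //].
by rewrite (ord1 j); have -> : lift 0 0 = 1 :> 'I_2 by exact/val_inj.
Qed.

(** A preimage has the modulus r of w and half its angle a. The half-angle
    formulas give r^2 (1 + cos a) / 2 and r^2 (1 - cos a) / 2 for the squares
    of its coordinates ([A] and [B] below), and the product of the coordinates
    takes the sign [s] of w 0 1. *)
Lemma f_surj w : exists u, f u = w.
Proof.
have [->|w0] := eqVneq w 0; first by exists 0; rewrite f0.
set r := enorm w; have r0 : 0 <= r by exact: enorm_ge0.
have /ler_normlP[wl wr] := normr_coord_le w 0; rewrite -/r in wl wr.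
have r2 : r ^+ 2 = w 0 0 ^+ 2 + w 0 1 ^+ 2 by exact: enorm2E.
have rE : enorm w = r by []; clearbody r.
pose s : R := if 0 <= w 0 1 then 1 else -1.
have s2 : s ^+ 2 = 1 by rewrite /s; case: ifP => _; rewrite ?expr1n ?sqrrN ?expr1n.
have sw : s * `|w 0 1| = w 0 1.
  rewrite /s; case: ifPn => [/ger0_norm ->|]; first by rewrite mul1r.
  by rewrite -ltNge => /ltr0_norm ->; rewrite mulN1r opprK.
pose A := r * (r + w 0 0) / 2; pose B := r * (r - w 0 0) / 2.
have A0 : 0 <= A by rewrite divr_ge0 // mulr_ge0 //; lra.
have B0 : 0 <= B by rewrite divr_ge0 // mulr_ge0 //; lra.
pose u : 'rV[R]_2 :=
  \row_j (if j == 0 then Num.sqrt A else s * Num.sqrt B).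
have u0 : u 0 0 = Num.sqrt A by rewrite mxE.
have u1 : u 0 1 = s * Num.sqrt B by rewrite mxE.
exists u; apply: f_eq => //; rewrite rE.
- apply: enorm_sqrP => //; rewrite inner2E -!expr2 u0 u1 exprMn s2.
  by rewrite !sqr_sqrtr // /A /B; field.
- by rewrite u0 u1 exprMn s2 !sqr_sqrtr // /A /B; field.
rewrite u0 u1.
have -> : 2 * Num.sqrt A * (s * Num.sqrt B) = s * (2 * Num.sqrt (A * B)).
  by rewrite (sqrtrM B A0); ring.
have -> : A * B = (r * w 0 1 / 2) ^+ 2.
  have -> : A * B = r ^+ 2 * (r ^+ 2 - w 0 0 ^+ 2) / 4 by rewrite /A /B; field.
  have -> : r ^+ 2 - w 0 0 ^+ 2 = w 0 1 ^+ 2 by rewrite r2; ring.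
  by field.
rewrite sqrtr_sqr !normrM (ger0_norm r0) (@ger0_norm _ 2^-1) ?invr_ge0 //.
by rewrite -[in RHS]sw; field.
Qed.

Lemma fN u : f (- u) = f u.
Proof.
by rewrite /f oppr_eq0 !mxE !sqrrN !(mulrN, mulNr) opprK.
Qed.

(** As |f u| = |u| and |f z| = |z|, it suffices that <f u, f z> <= <u, z>. With
    N = |u| |z| and 0 <= P = <u, z> <= N this is 2 P^2 - N^2 <= N P, that is
    (2 P + N) (P - N) <= 0. *)
Lemma f_expand u z : 0 <= inner u z -> enorm (u - z) <= enorm (f u - f z).
Proof.
move=> uz0; rewrite -ler_sqr ?nnegrE ?enorm_ge0 // !sqr_enormB !enorm_f.
rewrite lerD2l lerN2 ler_pM2l //.
have uzN := inner_le_enorm u z.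
have [N0|N0] := eqVneq (enorm u * enorm z) 0.
  apply: le_trans (inner_le_enorm _ _) _.
  by rewrite !enorm_f N0.
have Np : 0 < enorm u * enorm z by rewrite lt_def N0 mulr_ge0 ?enorm_ge0.
rewrite -(ler_pM2l Np) inner_f.
move: uz0 uzN Np; move: (inner u z) (enorm u * enorm z) => P N; nra.
Qed.

(** Of the two preimages u and - u of w, take the one whose inner product with
    z is nonnegative. *)
Lemma f_open z w : exists2 u, f u = w & enorm (u - z) <= enorm (w - f z).
Proof.
have [u fu] := f_surj w.
have [uz|uz] := leP 0 (inner u z).
  by exists u => //; rewrite -fu; exact: f_expand.
exists (- u); first by rewrite fN.
by rewrite -fu -(fN u); apply: f_expand; rewrite innerNl oppr_ge0 ltW.
Qed.

(** Up to the factor |z|, the numerator of the difference quotient is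
    <z, u> - <f z, f u>. With P = <z, u> and N = |z| |u| this equals, for u <> 0,
    (N - P) (N + 2 P) / N <= 3 (N - P), and 2 (N - P) <= |u - z|^2: it is of
    second order in |u - z|. *)
Lemma coderivative_f_radial z : z != 0 ->
  coderivative (@f R) z ((enorm z)^-1 *: f z) ((enorm z)^-1 *: z).
Proof.
rewrite -enorm_eq0 => z0; apply/coderivativeP => e e0.
have s0 : 0 < enorm z by rewrite lt_def z0 enorm_ge0.
(* On this ball (3 / 2) |u - z|^2 <= |z| e |u - z|. *)
exists (2 * enorm z * e / 3); first by rewrite divr_gt0 // !mulr_gt0.
move=> u ud; rewrite !innerZl -mulrBr ler_pdivrMl //.
rewrite !innerBr -!sqr_enorm enorm_f opprB addrA subrK.
have key : inner z u - inner (f z) (f u) <= 3 * (enorm z * enorm u - inner z u).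
  have [u0|u0] := eqVneq (enorm u) 0.
    move/eqP: (u0); rewrite enorm_eq0 => /eqP ->; rewrite f0 enorm0.
    by rewrite /inner !big1 ?subrr ?mulr0 ?subr0 ?mulr0 // => i _; rewrite mxE mulr0.
  have Np : 0 < enorm z * enorm u by rewrite mulr_gt0 // lt_def u0 enorm_ge0.
  have PN := inner_le_enorm z u.
  rewrite -(ler_pM2l Np) mulrBr inner_f.
  move: PN Np; move: (inner z u) (enorm z * enorm u) => P N; nra.
apply: le_trans key _.
apply: (@le_trans _ _ (3 / 2 * enorm (u - z) ^+ 2)).
  rewrite sqr_enormB (innerC u z).
  have := sqr_ge0 (enorm z - enorm u); lra.
apply: (@le_trans _ _ (enorm z * (e * enorm (u - z)))).
  rewrite expr2 !mulrA ler_wpM2r ?enorm_ge0 //; lra.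
rewrite ler_pM2l // ler_pM2l // lerDl enorm_ge0 //.
Qed.

Lemma enorm_scale_inv z : z != 0 -> enorm ((enorm z)^-1 *: z) = 1.
Proof.
rewrite -enorm_eq0 => z0.
by rewrite enormZ ger0_norm ?invr_ge0 ?enorm_ge0 // mulVf.
Qed.

End AngleDoubling.

Theorem theorem3p5 (R : realType) (zbar : 'rV[R]_2) :
  covering_constant (@f R) zbar (f zbar) = 1%:E.
Proof.
have near_nonzero eta : 0 < eta -> exists z : 'rV[R]_2,
    [/\ z != 0, enorm (z - zbar) <= eta & enorm (f z - f zbar) <= eta].
  move=> eta0; have [->|zbar0] := eqVneq zbar 0; last first.
    by exists zbar; rewrite !subrr enorm0 ltW.
  (* At the origin the radial direction is undefined, so move off by eta. *)
  pose z : 'rV[R]_2 := eta *: delta_mx 0 0.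
  have ez : enorm z = eta.
    apply: enorm_sqrP; rewrite ?ltW // inner2E !mxE /=; ring.
  exists z; rewrite f0 !subr0 enorm_f ez lexx; split=> //.
  by rewrite -enorm_eq0 ez gt_eqF.
apply/eqP; rewrite eq_le; apply/andP; split.
  apply: ge_ereal_sup => _ [eta /= eta0 <-].
  have [z [z0 zz fz]] := near_nonzero eta eta0.
  apply: ereal_inf_lbound.
  exists ((enorm z)^-1 *: z), z, ((enorm z)^-1 *: f z); split=> //.
  - exact: coderivative_f_radial.
  - by rewrite -(enorm_f z) enorm_scale_inv // -enorm_eq0 enorm_f enorm_eq0.
  - by rewrite enorm_scale_inv.
apply: (le_trans _ (ereal_sup_ubound _)); last by exists 1; rewrite /=.
apply: le_ereal_inf_tmp => _ [x [z [y [zD _ _ y1 ->]]]].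
rewrite lee_fin; exact: coderivative_enorm_ge1 (f_open z) zD y1.
Qed.
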